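(* Let $d\ge1$ and consider the $d\times d$ matrix $$A=\begin{pmatrix}11&12&\dots&1d\\21&22&\dots&2d\\ \vdots&\vdots&\ddots&\vdots\\ d1&d2&\dots&dd\end{pmatrix}$$ whose $(i,j)$ entry is the two-letter word $ij$, with coefficients in the (commutative) shuffle algebra $(T(\mathbb{R}^d),\star,e)$. Let $\det_\star(A)$ be its determinant, where the product is the shuffle product $\star$. Then $$2^d\,\mathrm{det}_\star(A)=\mathrm{inv}_d\star\mathrm{inv}_d.$$
   Context: $T(\mathbb{R}^d)=\mathbb{R}\langle x_1,\dots,x_d\rangle$ is the real vector space with basis the words in the alphabet $\{1,\dots,d\}$ (the word $i_1\dots i_k$ corresponding to the monomial $x_{i_1}\cdots x_{i_k}$, and the empty word $e$ to $1$). The shuffle product $\star$ is the bilinear product defined recursively on words by $e\star w=w\star e=w$ and $(w_1a)\star(w_2b)=(w_1\star(w_2b))a+((w_1a)\star w_2)b$ for words $w_1,w_2$ and letters $a,b$, where juxtaposition is concatenation. It makes $T(\mathbb{R}^d)$ a commutative algebra with unit $e$. $\mathrm{inv}_d=\sum_{\rho\in S_d}\mathrm{sgn}(\rho)\,\rho(1)\rho(2)\dots\rho(d)\in T(\mathbb{R}^d)$, a signed sum of $d!$ words of length $d$. *)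

(* Defs.v *)
From HB Require Import structures.
From mathcomp Require Import all_boot all_order all_fingroup all_algebra.
From mathcomp Require Import finmap.
From mathcomp Require Import monalg reals.

Set Implicit Arguments.
Unset Strict Implicit.
Unset Printing Implicit Defensive.

Import GRing.Theory.
Local Open Scope ring_scope.

(* T(R^d), the free module on the words in the alphabet 'I_d = {0, ..., d-1}
   (so that the letter k of the alphabet {1, ..., d} is the ordinal k-1).  It is
   an alias of {malg R[seq 'I_d]}, which has only a module structure; the alias
   carries the ring structure given by the shuffle product. *)
Definition shuffle_alg (R : comNzRingType) (d : nat) : Type :=
  {malg R[seq 'I_d]}.

HB.instance Definition _ (R : comNzRingType) (d : nat) :=
  GRing.Lmodule.copy (shuffle_alg R d) {malg R[seq 'I_d]}.

HB.lock Definition word (R : comNzRingType) (d : nat) (w : seq 'I_d) :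
  shuffle_alg R d := << w >>.
Arguments word R {d} w.

HB.lock Definition linext (R : comNzRingType) (d : nat) (V : lmodType R)
    (f : seq 'I_d -> V) (p : shuffle_alg R d) : V :=
  \sum_(w <- msupp p) p@_w *: f w.

Section LinearExtension.
Variables (R : comNzRingType) (d : nat).
Local Notation T := (shuffle_alg R d).

Variables (V : lmodType R) (f : seq 'I_d -> V).

Lemma linextE p : linext f p = \sum_(w <- msupp p) p@_w *: f w.
Proof. by rewrite linext.unlock. Qed.

Lemma linextEw (A : {fset seq 'I_d}) (p : T) :
  (msupp p `<=` A)%fset -> linext f p = \sum_(w <- A) p@_w *: f w.
Proof.
move=> sA; rewrite linext.unlock; apply: big_fset_incl => // w _ wp.
by rewrite mcoeff_outdom // scale0r.
Qed.

Fact linext_is_linear : linear (linext f).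
Proof.
move=> c p q; pose A := (msupp p `|` msupp q `|` msupp (c *: p + q : {malg R[_]}))%fset.
rewrite (@linextEw A (c *: p + q)) ?fsubsetUr //.
rewrite (@linextEw A p); last by rewrite /A -fsetUA fsubsetUl.
rewrite (@linextEw A q); last by rewrite /A fsetUAC fsubsetUr.
rewrite scaler_sumr -big_split /=; apply: eq_bigr => w _.
by rewrite mcoeffD mcoeffZ scalerDl scalerA.
Qed.
HB.instance Definition _ :=
  GRing.isLinear.Build R T V *:%R (linext f) linext_is_linear.

Lemma linext_word w : linext f (word R w) = f w.
Proof. by rewrite linext.unlock word.unlock msuppU oner_eq0 big_seq_fset1 mcoeffUU scale1r. Qed.

Lemma shuffle_algE (p : T) : p = \sum_(w <- msupp p) p@_w *: word R w.
Proof.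
rewrite {1}[p]monalgE; apply: eq_bigr => w _; apply/malgP => k.
by rewrite mcoeffZ word.unlock !mcoeffU mulrnAr mulr1.
Qed.

Lemma eq_linext (g : {linear T -> V}) :
  (forall w, g (word R w) = f w) -> linext f =1 g.
Proof.
move=> gf p; rewrite {2}[p]shuffle_algE linear_sum linext.unlock; apply: eq_bigr => w _.
by rewrite linearZ /= gf.
Qed.
End LinearExtension.

Section Shuffle.
Variables (R : comNzRingType) (d : nat).
Local Notation T := (shuffle_alg R d).
Local Notation word := (word R).

(* Concatenation with the letter a on the right, p |-> p a. *)
Definition rapp (a : 'I_d) : T -> T := linext (fun w => word (rcons w a)).
HB.instance Definition _ a := GRing.Linear.on (rapp a).

Lemma rapp_word a w : rapp a (word w) = word (rcons w a).
Proof. exact: linext_word. Qed.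

(* The recursion of the shuffle product consumes words from their last letter,
   hence it is structural on the reversed words: shuffle_rev u v is the shuffle
   of rev u and rev v. *)
Fixpoint shuffle_rev (u v : seq 'I_d) : T :=
  if u is a :: u' then
    (fix shuffle_rev_u v := if v is b :: v' then
       rapp a (shuffle_rev u' v) + rapp b (shuffle_rev_u v')
     else word (rev u)) v
  else word (rev v).

Definition shuffle_word (u v : seq 'I_d) : T := shuffle_rev (rev u) (rev v).

Lemma shuffle_word0w w : shuffle_word [::] w = word w.
Proof. by rewrite /shuffle_word /= revK. Qed.

Lemma shuffle_wordw0 w : shuffle_word w [::] = word w.
Proof.
by rewrite /shuffle_word; case/lastP: w => [|w a] //=; rewrite rev_rcons /= -rev_rcons revK.
Qed.

Lemma shuffle_word_rcons u v a b :
  shuffle_word (rcons u a) (rcons v b) =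
    rapp a (shuffle_word u (rcons v b)) + rapp b (shuffle_word (rcons u a) v).
Proof. by rewrite /shuffle_word !rev_rcons. Qed.

Definition shuffle (p q : T) : T :=
  linext (fun u => linext (shuffle_word u) q) p.

Lemma shuffle_words u v : shuffle (word u) (word v) = shuffle_word u v.
Proof. by rewrite /shuffle !linext_word. Qed.

Fact shuffle_linear_l q : linear (shuffle^~ q).
Proof. by move=> c p p'; rewrite /shuffle linearP. Qed.
Fact shuffle_linear_r p : linear (shuffle p).
Proof.
move=> c q q'; rewrite /shuffle !(linextE (fun=> _)) scaler_sumr.
rewrite -big_split /=; apply: eq_bigr => w _; rewrite linearP scalerDr !scalerA.
by rewrite mulrC.
Qed.

Lemma shuffleDl : left_distributive shuffle +%R.
Proof. by move=> p p' q; rewrite -[p]scale1r shuffle_linear_l !scale1r. Qed.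
Lemma shuffleDr : right_distributive shuffle +%R.
Proof. by move=> p q q'; rewrite -[q]scale1r shuffle_linear_r !scale1r. Qed.
Lemma shuffle0p q : shuffle 0 q = 0.
Proof. by apply: (addrI (shuffle 0 q)); rewrite -shuffleDl !addr0. Qed.
Lemma shufflep0 p : shuffle p 0 = 0.
Proof. by apply: (addrI (shuffle p 0)); rewrite -shuffleDr !addr0. Qed.
Lemma shuffleZl c p q : shuffle (c *: p) q = c *: shuffle p q.
Proof. by rewrite -[c *: p]addr0 shuffle_linear_l shuffle0p addr0. Qed.
Lemma shuffleZr c p q : shuffle p (c *: q) = c *: shuffle p q.
Proof. by rewrite -[c *: q]addr0 shuffle_linear_r shufflep0 addr0. Qed.

Lemma word_ind (P : T -> Prop) :
    P 0 -> (forall c p q, P p -> P q -> P (c *: p + q)) ->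
  (forall w, P (word w)) -> forall p, P p.
Proof.
move=> P0 PD Pw p; rewrite [p]shuffle_algE.
elim: (enum_fset (msupp p)) => [|w s IH]; first by rewrite big_nil.
by rewrite big_cons; apply: PD.
Qed.

Lemma shuffle_rapp a b p q :
  shuffle (rapp a p) (rapp b q) =
    rapp a (shuffle p (rapp b q)) + rapp b (shuffle (rapp a p) q).
Proof.
elim/word_ind: p q => [|c p p' IH IH'|u] q.
- by rewrite !linear0 !shuffle0p !linear0 addr0.
- by rewrite linearP !shuffle_linear_l IH IH' !linearP scalerDr addrACA.
elim/word_ind: q => [|c q q' IH IH'|v].
- by rewrite !linear0 !shufflep0 !linear0 addr0.
- by rewrite linearP !shuffle_linear_r IH IH' !linearP scalerDr addrACA.
by rewrite !rapp_word !shuffle_words shuffle_word_rcons.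
Qed.

Lemma shuffle1p : left_id (word [::]) shuffle.
Proof.
elim/word_ind=> [|c p q IHp IHq|w]; first exact: shufflep0.
  by rewrite shuffle_linear_r IHp IHq.
by rewrite shuffle_words shuffle_word0w.
Qed.

Lemma shuffleC : commutative shuffle.
Proof.
elim/word_ind=> [|c p p' IHp IHp'|u] q; first by rewrite shuffle0p shufflep0.
  by rewrite shuffle_linear_l shuffle_linear_r IHp IHp'.
elim/word_ind: q => [|c q q' IHq IHq'|v]; first by rewrite shuffle0p shufflep0.
  by rewrite shuffle_linear_l shuffle_linear_r IHq IHq'.
elim/last_ind: u v => [|u a IHu] v.
  by rewrite !shuffle_words shuffle_word0w shuffle_wordw0.
elim/last_ind: v => [|v b IHv].
  by rewrite !shuffle_words shuffle_word0w shuffle_wordw0.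
by rewrite -!rapp_word !shuffle_rapp !rapp_word IHu IHv addrC.
Qed.

Lemma shufflep1 : right_id (word [::]) shuffle.
Proof. by move=> p; rewrite shuffleC shuffle1p. Qed.

Lemma shuffleA : associative shuffle.
Proof.
elim/word_ind=> [|c p p' IH IH'|u] q r; first by rewrite !shuffle0p.
  by rewrite !shuffle_linear_l IH IH'.
elim/word_ind: q => [|c q q' IH IH'|v]; first by rewrite !(shuffle0p, shufflep0).
  by rewrite shuffle_linear_r shuffle_linear_l shuffle_linear_r shuffle_linear_l IH IH'.
elim/word_ind: r => [|c r r' IH IH'|w]; first by rewrite !shufflep0.
  by rewrite 3!shuffle_linear_r IH IH'.
elim/last_ind: u v w => [|u a IHu] v w; first by rewrite !shuffle1p.
elim/last_ind: v w => [|v b IHv] w; first by rewrite shufflep1 shuffle1p.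
elim/last_ind: w => [|w c IHw]; first by rewrite !shufflep1.
move: (IHu (rcons v b) (rcons w c)) (IHv (rcons w c)) IHw.
rewrite -!rapp_word.
move: (word u) (word v) (word w) => A B C eA eB eC.
have eL : shuffle (rapp a A) (shuffle (rapp b B) (rapp c C)) =
    rapp a (shuffle A (shuffle (rapp b B) (rapp c C)))
    + (rapp b (shuffle (rapp a A) (shuffle B (rapp c C)))
       + rapp c (shuffle (rapp a A) (shuffle (rapp b B) C))).
  rewrite (shuffle_rapp b c) 2!shuffleDr (shuffle_rapp a b) (shuffle_rapp a c).
  by rewrite linearD addrACA.
have eR : shuffle (shuffle (rapp a A) (rapp b B)) (rapp c C) =
    rapp a (shuffle (shuffle A (rapp b B)) (rapp c C))
    + (rapp b (shuffle (shuffle (rapp a A) B) (rapp c C))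
       + rapp c (shuffle (shuffle (rapp a A) (rapp b B)) C)).
  rewrite (shuffle_rapp a b) 2!shuffleDl (shuffle_rapp a c) (shuffle_rapp b c).
  by rewrite linearD addrACA -addrA.
by rewrite eL eR eA eB eC.
Qed.

Fact word_nil_neq0 : word [::] != 0 :> T.
Proof. by rewrite word.unlock monalgU_eq0 oner_eq0. Qed.

HB.instance Definition _ := GRing.Zmodule_isComNzRing.Build T
  shuffleA shuffleC shuffle1p shuffleDl word_nil_neq0.

Fact shuffle_scaleAl (c : R) (p q : T) : c *: (p * q) = (c *: p) * q.
Proof. by rewrite -[RHS]/(shuffle _ _) shuffleZl. Qed.
HB.instance Definition _ := GRing.Lmodule_isLalgebra.Build R T shuffle_scaleAl.
HB.instance Definition _ := GRing.Lalgebra_isComAlgebra.Build R T.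

Lemma word0w_mul w : word [::] * word w = word w.
Proof. exact: mul1r. Qed.

Lemma word_rcons_mul u v a b :
  word (rcons u a) * word (rcons v b) =
    rapp a (word u * word (rcons v b)) + rapp b (word (rcons u a) * word v).
Proof. by rewrite -!rapp_word; exact: shuffle_rapp. Qed.

Definition inv_d : T :=
  \sum_(s : 'S_d) (-1) ^+ s *: word [seq s i | i <- enum 'I_d].

Definition two_letter_matrix : 'M[T]_d := \matrix_(i, j) word [:: i; j].

End Shuffle.
Arguments inv_d R d : clear implicits.
Arguments two_letter_matrix R d : clear implicits.

(* Main.v *)
Require Import Defs.
From HB Require Import structures.
From mathcomp Require Import all_boot all_order all_fingroup all_algebra.
From mathcomp Require Import monalg reals zify.
Import GRing.Theory.
Local Open Scope ring_scope.

Set Implicit Arguments.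
Unset Strict Implicit.
Unset Printing Implicit Defensive.

(** Write [w_S] for the minor of the d x 2d matrix [(delta_(i, w_j))] of a word
w of length 2d on the columns S.  The coefficient of w in inv_d * inv_d is the
sum of [w_S] [w_(S^c)] over all S with d elements, and the coefficient of w in
det A turns out to be [w_even] [w_odd] for the even and the odd positions, counted from 0: of
all the ways to cut w into d two-letter words, the alternation over rows and
columns leaves only the interleaving one.  So the theorem is the identity
  sum_S [w_S] [w_(S^c)] = 2^d [w_even] [w_odd].

By Laplace expansion along two blocks of rows, both sides are 2d x 2d
determinants.  Let X be the matrix above, D the diagonal matrix of the signs
(-1)^j, and X0, X1 the matrix X with its odd, respectively even, columns set to
zero.  The signs of the expansion of det [X; X D] are independent of S, because
the signs of D cancel those of Laplace, so this determinant is, up to sign, the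
left hand sum; det [X0; X1] is [w_even] [w_odd] up to sign.  Finally
[X; X D] = [1, 1; 1, -1] [X0; X1], where det [1, 1; 1, -1] = (-2)^d
([alt_sign_parity]).

The block determinants are organised as elements of the shuffle algebra:
[alt e s] is the combination of words whose coefficients are the determinants
with rows given by s ([mcoeff_alt]).  The two Laplace expansions become
identities between such elements ([altM] for inv_d * inv_d and [det_two_letter]
for det A).  They are proved by induction on the degree, using that deleting a
last letter c is a derivation [lder c] of the shuffle product ([lderM]), and that
the counit and these derivations together separate points ([lder_inj]).  On
[alt e s], the derivation [lder c] is the expansion along the last column
([lder_alt]). *)

(** * Deletion of the last letter as a derivation *)

Section Deconcatenation.
Variables (R : comNzRingType) (d : nat).
Local Notation T := (shuffle_alg R d).
Local Notation word := (word R).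

Definition word_lder (c : 'I_d) (w : seq 'I_d) : T :=
  if rev w is a :: w' then (a == c)%:R *: word (rev w') else 0.

Definition lder c : T -> T := linext (word_lder c).
HB.instance Definition _ c := GRing.Linear.on (lder c).

Lemma lder1 c : lder c 1 = 0.
Proof. by rewrite -[1]/(word [::]) /lder linext_word. Qed.

Lemma lder_word_rcons c w a : lder c (word (rcons w a)) = (a == c)%:R *: word w.
Proof. by rewrite /lder linext_word /word_lder rev_rcons revK. Qed.

Lemma lder_rapp c a p : lder c (rapp a p) = (a == c)%:R *: p.
Proof.
elim/word_ind: p => [|k p q IHp IHq|w]; first by rewrite !linear0.
  by rewrite !linearP /= IHp IHq.
by rewrite rapp_word lder_word_rcons.
Qed.

(** The last letter of a shuffle of two words is the last letter of one of them,
so deleting it acts on one factor at a time. *)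
Lemma lderM c (p q : T) : lder c (p * q) = lder c p * q + p * lder c q.
Proof.
elim/word_ind: p q => [|k p p' IH IH'|u] q.
- by rewrite mul0r !linear0 !mul0r addr0.
- by rewrite mulrDl -scalerAl !linearP /= IH IH' !mulrDl -!scalerAl scalerDr addrACA.
elim/word_ind: q => [|k q q' IH IH'|v].
- by rewrite mulr0 !linear0 !mulr0 addr0.
- by rewrite mulrDr -scalerAr !linearP /= IH IH' !mulrDr -!scalerAr scalerDr addrACA.
case/lastP: u => [|u a].
  by rewrite -[word [::]]/(1 : T) !mul1r lder1 mul0r add0r.
case/lastP: v => [|v b].
  by rewrite -[word [::]]/(1 : T) !mulr1 lder1 mulr0 addr0.
rewrite word_rcons_mul linearD /= !lder_rapp !lder_word_rcons.
by rewrite -scalerAl -scalerAr.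
Qed.

Lemma mcoeff_word (v w : seq 'I_d) : (word v)@_w = (v == w)%:R.
Proof. by rewrite word.unlock mcoeffU. Qed.

Lemma mcoeff_lder c (p : T) w : (lder c p)@_w = p@_(rcons w c).
Proof.
elim/word_ind: p => [|k p q IHp IHq|v]; first by rewrite linear0 !mcoeff0.
  by rewrite linearP !mcoeffD !mcoeffZ IHp IHq.
case/lastP: v => [|v a].
  by rewrite -[word [::]]/(1 : T) lder1 mcoeff0 mcoeff_word; case: w.
rewrite lder_word_rcons mcoeffZ !mcoeff_word eqseq_rcons -natrM mulnb.
by rewrite andbC.
Qed.

Definition counit (p : T) : R := p@_[::].

Lemma counit_is_zmod_morphism : zmod_morphism counit.
Proof. by move=> p q; rewrite /counit mcoeffB. Qed.
HB.instance Definition _ :=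
  GRing.isZmodMorphism.Build T R counit counit_is_zmod_morphism.

Lemma counit_rapp a p : counit (rapp a p) = 0.
Proof.
rewrite /counit; elim/word_ind: p => [|k p q IHp IHq|w].
- by rewrite linear0 mcoeff0.
- by rewrite linearP mcoeffD mcoeffZ IHp IHq mulr0 addr0.
by rewrite rapp_word mcoeff_word; case: w.
Qed.

Lemma counit_word w : counit (word w) = (w == [::])%:R.
Proof. exact: mcoeff_word. Qed.

Lemma counitZ k p : counit (k *: p) = k * counit p.
Proof. exact: mcoeffZ. Qed.

Lemma counit_is_monoid_morphism : monoid_morphism counit.
Proof.
have c1 : counit 1 = 1 by rewrite -[1]/(word [::]) counit_word.
split=> // p q.
elim/word_ind: p q => [|k p p' IH IH'|u] q.
- by rewrite mul0r !raddf0 mul0r.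
- by rewrite mulrDl -scalerAl !raddfD /= !counitZ IH IH' mulrDl mulrA.
elim/word_ind: q => [|k q q' IH IH'|v].
- by rewrite mulr0 !raddf0 mulr0.
- by rewrite mulrDr -scalerAr !raddfD /= !counitZ IH IH' mulrDr mulrCA.
case/lastP: u => [|u a].
  by rewrite -[word [::]]/(1 : T) mul1r c1 mul1r.
case/lastP: v => [|v b].
  by rewrite -[word [::]]/(1 : T) mulr1 c1 mulr1.
by rewrite word_rcons_mul -!rapp_word raddfD /= !counit_rapp addr0 mulr0.
Qed.
HB.instance Definition _ :=
  GRing.isMonoidMorphism.Build T R counit counit_is_monoid_morphism.

(** The induction principle of the file: each word of positive length has a last
letter, so an element is known from its counit and from its derivatives, which
have lower degree. *)
Lemma lder_inj (p q : T) :
  counit p = counit q -> (forall c, lder c p = lder c q) -> p = q.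
Proof.
move=> eq0 eqD; apply/malgP => w; case/lastP: w => [|w c]; first exact: eq0.
by rewrite -!mcoeff_lder eqD.
Qed.

Lemma lder_prod c n (F : 'I_n -> T) :
  lder c (\prod_i F i) = \sum_i \prod_j (if j == i then lder c (F j) else F j).
Proof.
elim: n F => [|n IH] F; first by rewrite !big_ord0 lder1.
rewrite big_ord_recl lderM IH big_ord_recl; congr (_ + _).
  by rewrite big_ord_recl.
rewrite mulr_sumr; apply: eq_bigr => i _; rewrite big_ord_recl /=.
by congr (_ * _); apply: eq_bigr => j _; rewrite (inj_eq lift_inj).
Qed.

(** The Leibniz rule for determinants, one row at a time. *)
Lemma lder_det c n (M : 'M[T]_n) :
  lder c (\det M) =
    \sum_i \det (\matrix_(i', j) if i' == i then lder c (M i' j) else M i' j).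
Proof.
rewrite /determinant linear_sum exchange_big; apply: eq_bigr => s _ /=.
rewrite -mulr_sumr mulr_sign (fun_if (lder c)) linearN -mulr_sign lder_prod.
congr (_ * _); apply: eq_bigr => i _; apply: eq_bigr => j _.
by rewrite mxE.
Qed.

End Deconcatenation.

(** * Deleting one entry of a sequence *)

Definition del (X : Type) (i : nat) (s : seq X) : seq X := take i s ++ drop i.+1 s.

Lemma size_del (X : Type) i (s : seq X) : (i < size s)%N -> size (del i s) = (size s).-1.
Proof. by move=> lt_is; rewrite size_cat size_take size_drop lt_is; lia. Qed.

Lemma nth_del (X : Type) (x0 : X) i (s : seq X) j :
  (i < size s)%N -> nth x0 (del i s) j = nth x0 s (bump i j).
Proof.
move=> lt_is; rewrite nth_cat size_take lt_is /bump (leqNgt i); case: ltnP => ij /=.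
  by rewrite nth_take // add0n.
by rewrite nth_drop; congr nth; lia.
Qed.

Lemma del_map (X Y : Type) (f : X -> Y) i (s : seq X) : del i (map f s) = map f (del i s).
Proof. by rewrite /del map_cat map_take map_drop. Qed.

Lemma del_cat_l (X : Type) i (s t : seq X) : (i < size s)%N -> del i (s ++ t) = del i s ++ t.
Proof.
move=> lt_is; rewrite /del take_cat drop_cat lt_is.
case: (ltnP i.+1 (size s)) => [_|le_si]; first by rewrite catA.
have eq_is : i.+1 = size s by apply/eqP; rewrite eqn_leq lt_is.
by rewrite eq_is subnn drop0 drop_size cats0.
Qed.

Lemma del_cat_r (X : Type) i (s t : seq X) : del (size s + i) (s ++ t) = s ++ del i t.
Proof.
by rewrite /del take_cat drop_cat !ltnNge leq_addr -addnS leq_addr /= !addKn catA.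
Qed.

(** * Determinantal combinations of words *)

(** Expansion along the last column: the letter c contributed by row i is put in
last position, after a combination of words built from the other rows. *)
Fixpoint altn (R : comNzRingType) (d : nat) (X : Type) (x0 : X)
    (e : X -> nat -> 'I_d -> R) (n : nat) (s : seq X) : shuffle_alg R d :=
  if n is m.+1 then
    \sum_(i < n) (-1) ^+ (i + m) *:
      \sum_c e (nth x0 s i) m c *: rapp c (altn x0 e m (del i s))
  else 1.

(** The words w with coefficients [\det (e s_i j w_j)], see [mcoeff_alt]: an entry x
of s stands for the row whose coefficient at position j and letter c is [e x j c].
The dependence of e on j lets a row carry signs or zeros that depend on the
position.  The default [x0] is never read.  The definition is locked to keep
unification from unfolding the recursion. *)
HB.lock Definition alt (R : comNzRingType) (d : nat) (X : Type) (x0 : X)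
    (e : X -> nat -> 'I_d -> R) (s : seq X) : shuffle_alg R d :=
  altn x0 e (size s) s.

Section AlternatingTensor.
Variables (R : comNzRingType) (d : nat).
Local Notation T := (shuffle_alg R d).
Local Notation word := (word R).

Variables (X : Type) (x0 : X) (e : X -> nat -> 'I_d -> R).
Local Notation alt := (alt x0 e).
Local Notation altn := (altn x0 e).

Lemma altE s : alt s = altn (size s) s.
Proof. by rewrite alt.unlock. Qed.

Lemma alt_nil : alt [::] = 1.
Proof. by rewrite altE. Qed.

Lemma counit_alt s : counit (alt s) = (nilp s)%:R.
Proof.
rewrite altE /nilp; case: (size s) => [|m] /=; first exact: rmorph1.
rewrite raddf_sum big1 // => i _; rewrite /= counitZ raddf_sum big1 ?mulr0 // => c _.
by rewrite /= counitZ counit_rapp mulr0.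
Qed.

Lemma lder_alt c m s : size s = m ->
  lder c (alt s) =
    \sum_(i < m) (-1) ^+ (i + m.-1) *: (e (nth x0 s i) m.-1 c *: alt (del i s)).
Proof.
move=> sz_s; rewrite {1}altE sz_s; case: m sz_s => [|m] sz_s; first by rewrite big_ord0 lder1.
rewrite linear_sum; apply: eq_bigr => i _; rewrite linearZ linear_sum /=; congr (_ *: _).
have -> : alt (del i s) = altn m (del i s) by rewrite !altE size_del sz_s.
rewrite (bigD1 c) //= linearZ /= lder_rapp eqxx scale1r big1 ?addr0 // => b neq_bc.
by rewrite linearZ /= lder_rapp (negPf neq_bc) scale0r scaler0.
Qed.

(** Deleting the last letter of the word matches deleting the last column of the
determinant, so the recursive definition is the cofactor expansion. *)
Lemma mcoeff_alt a0 n s w : size s = n ->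
  (alt s)@_w = (size w == n)%:R *
    \det (\matrix_(i < n, j < n) e (nth x0 s i) j (nth a0 w j)).
Proof.
elim: n => [|n IH] in s w *.
  move/size0nil=> ->; rewrite alt_nil det_mx00 mulr1.
  by rewrite -[1]/(word [::]) mcoeff_word; case: w.
move=> sz_s; case/lastP: w => [|w c].
  rewrite mul0r -[_@__]/(counit _) counit_alt /nilp; by rewrite sz_s.
rewrite -mcoeff_lder (lder_alt c sz_s) (raddf_sum (mcoeff w)) /= size_rcons eqSS.
case: (eqVneq (size w) n) => [sz_w|sz_w]; last first.
  rewrite mul0r big1 // => i _; rewrite !mcoeffZ IH ?size_del ?sz_s //.
  by rewrite (negPf sz_w) mul0r !mulr0.
rewrite mul1r (expand_det_col _ ord_max); apply: eq_bigr => i _.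
rewrite !mcoeffZ IH ?size_del ?sz_s // sz_w eqxx mul1r mxE /= mulrCA.
congr (_ * (_ * _)).
  by rewrite nth_rcons sz_w ltnn eqxx.
congr determinant; apply/matrixP => j k; rewrite !mxE nth_del ?sz_s //=.
have -> : bump n k = k by rewrite /bump leqNgt ltn_ord.
by rewrite nth_rcons sz_w ltn_ord.
Qed.

End AlternatingTensor.

Lemma eq_sign (R : pzRingType) m n : odd m = odd n -> (-1) ^+ m = (-1) ^+ n :> R.
Proof. by move=> eq_mn; rewrite -signr_odd eq_mn signr_odd. Qed.

Lemma mul_sign_scale (R : pzRingType) (A : lalgType R) n (x : A) :
  (-1) ^+ n * x = (-1) ^+ n *: x.
Proof. by rewrite -signr_odd -[in RHS]signr_odd mulr_sign scaler_sign. Qed.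

(** * The two Laplace expansions *)

Section Glue.
Variables (R : comNzRingType) (d : nat) (x0 : 'I_d).
Local Notation T := (shuffle_alg R d).
Local Notation word := (word R).

(** The tag records the block of rows that a letter belongs to. *)
Definition glue (a b : seq 'I_d) : seq (bool * 'I_d) :=
  map (pair false) a ++ map (pair true) b.

Lemma size_glue a b : size (glue a b) = (size a + size b)%N.
Proof. by rewrite size_cat !size_map. Qed.

Lemma lder_alt_glue (e : bool * 'I_d -> nat -> 'I_d -> R) c a b p q :
  size a = p -> size b = q ->
  lder c (alt (false, x0) e (glue a b)) =
    \sum_(i < p) (-1) ^+ (i + (p + q).-1) *:
      (e (false, nth x0 a i) (p + q).-1 c *: alt (false, x0) e (glue (del i a) b)) +
    \sum_(j < q) (-1) ^+ (p + j + (p + q).-1) *: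
      (e (true, nth x0 b j) (p + q).-1 c *: alt (false, x0) e (glue a (del j b))).
Proof.
move=> sz_a sz_b; rewrite (@lder_alt _ _ _ _ _ c (p + q)%N); last first.
  by rewrite size_glue sz_a sz_b.
rewrite big_split_ord /=.
apply: (f_equal2 +%R); apply: eq_bigr => i _; congr (_ *: (_ *: _)).
- by rewrite nth_cat size_map sz_a ltn_ord (nth_map x0) ?sz_a.
- by rewrite /glue del_cat_l ?size_map ?sz_a ?ltn_ord // del_map.
- by rewrite nth_cat size_map sz_a ltnNge leq_addr addKn /= (nth_map x0) ?sz_b.
- by rewrite /glue -sz_a -(size_map (pair false) a) del_cat_r del_map.
Qed.

(** The rows of the matrices X, [X; X D] and [X0; X1] of the introduction. *)
Definition plain_row (a : 'I_d) (j : nat) (c : 'I_d) : R := (a == c)%:R.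
Definition sign_row (x : bool * 'I_d) (j : nat) (c : 'I_d) : R :=
  (-1) ^+ (x.1 * j) * (x.2 == c)%:R.
Definition parity_row (x : bool * 'I_d) (j : nat) (c : 'I_d) : R :=
  ((odd j == x.1) && (x.2 == c))%:R.

Local Notation alt0 := (alt x0 plain_row).
Local Notation alts := (alt (false, x0) sign_row).
Local Notation altp := (alt (false, x0) parity_row).

(** A product of two determinants of complementary column sets, summed over the
column sets without the Laplace signs, is one determinant.  Deriving the left
side deletes a letter of a or of b with the sign of its own block; on the right
the sign comes from the position in the glued list and, for letters of b, from
[sign_row]; the exponent [p * q + 'C(q, 2)] is the one that satisfies both
recursions. *)
Lemma altM a b p q : size a = p -> size b = q ->
  alt0 a * alt0 b = (-1) ^+ (p * q + 'C(q, 2)) *: alts (glue a b).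
Proof.
have [n] := ubnP (p + q)%N; elim: n => // n IH in a b p q *.
move=> lt_n sz_a sz_b; apply: lder_inj => [|c].
  rewrite rmorphM /= counitZ !counit_alt /nilp size_glue sz_a sz_b addn_eq0.
  by case: p q {lt_n sz_a sz_b} => [|p] [|q]; rewrite ?mulr0 ?mul0r // expr0.
rewrite lderM linearZ /= (lder_alt _ _ c sz_a) (lder_alt _ _ c sz_b).
rewrite (lder_alt_glue _ c sz_a sz_b) scalerDr mulr_suml mulr_sumr !scaler_sumr.
apply: (f_equal2 +%R); apply: eq_bigr => i _.
  have lt_ip := ltn_ord i; have sz_d : size (del i a) = p.-1 by rewrite size_del ?sz_a.
  rewrite -scalerAl -scalerAl.
  have lt_pq : (p.-1 + q < n)%N by lia.
  have eqIH := IH (del i a) b p.-1 q lt_pq sz_d sz_b.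
  rewrite eqIH /plain_row /sign_row /= mul0n expr0 mul1r !scalerA; congr (_ *: _).
  rewrite mulrAC -exprD -exprD; congr (_ * _); apply: eq_sign.
  move: (nat_of_ord i) lt_ip => u; case: (p) => // p' _.
  by rewrite addSn mulSn /= !oddD !oddM;
  case: (odd u); case: (odd p'); case: (odd q); case: (odd 'C(q, 2)).
have lt_iq := ltn_ord i; have sz_d : size (del i b) = q.-1 by rewrite size_del ?sz_b.
rewrite -scalerAr -scalerAr.
have lt_pq : (p + q.-1 < n)%N by lia.
have eqIH := IH a (del i b) p q.-1 lt_pq sz_a sz_d.
rewrite eqIH /plain_row /sign_row /= mul1n !scalerA; congr (_ *: _).
rewrite mulrAC -exprD mulrA -!exprD; congr (_ * _); apply: eq_sign.
move: (nat_of_ord i) lt_iq => u; case: (q) => // q' _.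
by rewrite addnS mulnS binS bin1 /= !oddD !oddM;
  case: (odd u); case: (odd p); case: (odd q'); case: (odd 'C(q', 2)).
Qed.

(** [two_letter_mx] is laid out as the transpose of A, so that deriving it by the
last letter acts on a single row, replacing it by the row of the letters of a.
Moving that row to the top gives [bordered_mx], the intermediate object of odd
degree that closes the induction. *)
Definition bordered_mx k (a b : seq 'I_d) : 'M[T]_(k.+1) :=
  \matrix_(j, i) word (nth x0 a i :: (if nat_of_ord j is j'.+1 then [:: nth x0 b j'] else [::])).

Definition two_letter_mx k (a b : seq 'I_d) : 'M[T]_k :=
  \matrix_(j, i) word [:: nth x0 a i; nth x0 b j].

Lemma lder_word1 c a : lder c (word [:: a]) = (a == c)%:R :> T.
Proof. by rewrite -[[:: a]]/(rcons [::] a) lder_word_rcons scaler_nat. Qed.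

Lemma lder_word2 (c a b : 'I_d) : lder c (word [:: a; b]) = (b == c)%:R *: word [:: a].
Proof. by rewrite -[[:: a; b]]/(rcons [:: a] b) lder_word_rcons. Qed.

Lemma row'_bordered k a b i : size a = k.+1 ->
  row' ord0 (col' i (bordered_mx k a b)) = two_letter_mx k (del i a) b.
Proof.
move=> sz_a; apply/matrixP => j i'; rewrite !mxE /= nth_del ?sz_a //.
Qed.

(** Deriving a two-letter row would duplicate the row of single letters, so only
the derivative of that first row contributes. *)
Lemma lder_det_bordered c k a b : size a = k.+1 -> size b = k ->
  lder c (\det (bordered_mx k a b)) =
    \sum_(i < k.+1) (-1) ^+ i *: ((nth x0 a i == c)%:R *: \det (two_letter_mx k (del i a) b)).
Proof.
move=> sz_a sz_b; rewrite lder_det (bigD1 ord0 (erefl true)) /= [X in _ + X]big1 ?addr0; last first.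
  move=> j nz_j.
  have [[j' lt_j'] ->] : exists j' : 'I_k, j = lift ord0 j'.
    by case: (unliftP ord0 j) nz_j => [j' -> _|-> /eqP//]; exists j'.
  have [eq_c|neq_c] := eqVneq (nth x0 b j') c.
    apply: (@determinant_alternate _ _ _ (lift ord0 (Ordinal lt_j')) ord0) => // i.
    by rewrite !mxE eqxx /= lder_word2 eq_c eqxx scale1r.
  rewrite (expand_det_row _ (lift ord0 (Ordinal lt_j'))) big1 // => i _.
  by rewrite !mxE eqxx /= lder_word2 (negPf neq_c) scale0r mul0r.
rewrite (expand_det_row _ ord0); apply: eq_bigr => i _.
rewrite !mxE eqxx /= lder_word1 /cofactor add0n.
rewrite -(row'_bordered b i sz_a).
set M := row' _ (col' _ (\matrix_(_, _) _)); have -> : M = row' ord0 (col' i (bordered_mx k a b)).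
  by apply/matrixP => u v; rewrite !mxE.
by rewrite mulr_natl mul_sign_scale scaler_nat scalerMnr.
Qed.

(** The sign is that of moving row j to the top; it is read off by comparing the
expansions of both sides along the row of single letters. *)
Lemma lder_det_two_letter c k a b : size a = k.+1 -> size b = k.+1 ->
  lder c (\det (two_letter_mx k.+1 a b)) =
    \sum_(j < k.+1) (-1) ^+ j *: ((nth x0 b j == c)%:R *: \det (bordered_mx k a (del j b))).
Proof.
move=> sz_a sz_b; rewrite lder_det; apply: eq_bigr => j _.
have scale_sum (r : R) (F : 'I_k.+1 -> T) : r *: (\sum_i F i) = \sum_i r *: F i.
  exact: scaler_sumr.
rewrite (expand_det_row _ j) (expand_det_row _ ord0) !scale_sum; apply: eq_bigr => i _.
rewrite !mxE eqxx lder_word2 /= /cofactor add0n exprD (row'_bordered _ i sz_a).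
set M := row' _ _; have -> : M = two_letter_mx k (del i a) (del j b).
  apply/matrixP => u v; rewrite !mxE eq_sym (negPf (neq_lift _ _)).
  by rewrite !nth_del ?sz_a ?sz_b.
rewrite -scalerAl -mulrA !mul_sign_scale -scalerAr -scalerAr.
by rewrite !scalerA mulrCA mulrA.
Qed.

(** Two derivations lead from size k+1 to size k: the first one, at an odd
position, removes a letter of b, the second one, at an even position, a letter of
a.  This is the alternation encoded by [parity_row]; the sign accumulates one
factor (-1)^k for each k. *)
Lemma det_two_letter k a b : size a = k -> size b = k ->
  \det (two_letter_mx k a b) = (-1) ^+ 'C(k, 2) *: altp (glue a b).
Proof.
elim: k => [|k IH] in a b *.
  by move=> /size0nil-> /size0nil->; rewrite -[glue _ _]/[::] alt_nil det_mx00 expr0 scale1r.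
move=> sz_a sz_b.
(* The half step: the determinant with one letter of b already removed. *)
have bord b' : size b' = k ->
    \det (bordered_mx k a b') = (-1) ^+ 'C(k, 2) *: altp (glue a b').
  move=> sz_b'; apply: lder_inj => [|c].
    rewrite counitZ counit_alt /nilp size_glue sz_a /= mulr0 -det_map_mx.
    rewrite (expand_det_row _ ord0) big1 // => i _.
    by rewrite !mxE /= counit_word mul0r.
  rewrite (lder_det_bordered c sz_a sz_b') linearZ /= (lder_alt_glue _ c sz_a sz_b').
  rewrite [X in _ + X]big1 ?addr0; last first.
    by move=> j _; rewrite /parity_row /= addnn odd_double /= !(scale0r, scaler0).
  rewrite scaler_sumr; apply: eq_bigr => i _.
  have sz_d : size (del i a) = k by rewrite size_del ?sz_a.
  rewrite (IH _ _ sz_d sz_b') /parity_row /= addnn odd_double /=.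
  rewrite !scalerA; congr (_ *: _); rewrite mulrAC -!exprD.
  by congr (_ * _); apply: eq_sign; lia.
apply: lder_inj => [|c].
  rewrite counitZ counit_alt /nilp size_glue sz_a /= mulr0 -det_map_mx.
  rewrite (expand_det_row _ ord0) big1 // => i _.
  by rewrite !mxE /= counit_word mul0r.
rewrite (lder_det_two_letter c sz_a sz_b) linearZ /= (lder_alt_glue _ c sz_a sz_b).
rewrite [X in X + _]big1 ?add0r; last first.
  by move=> j _; rewrite /parity_row /= addnS addnn /= odd_double /= !(scale0r, scaler0).
rewrite scaler_sumr; apply: eq_bigr => i _.
have sz_d : size (del i b) = k by rewrite size_del ?sz_b.
rewrite (bord _ sz_d) /parity_row /= addnS addnn /= odd_double /=.
rewrite !scalerA; congr (_ *: _); rewrite mulrAC -!exprD.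
by congr (_ * _); apply: eq_sign; rewrite binS bin1; lia.
Qed.

(** The rows of the first block are the sums X0 + X1, those of the second block
the differences X0 - X1; this change of rows has determinant (-2)^n. *)
Lemma alt_sign_parity n a : size a = n ->
  alts (glue a a) = (-2) ^+ n *: altp (glue a a).
Proof.
move=> sz_a; apply/malgP => w; rewrite mcoeffZ.
have sz_g : size (glue a a) = (n + n)%N by rewrite size_glue sz_a.
rewrite !(mcoeff_alt _ _ x0 _ sz_g) mulrCA; congr (_ * _).
have rowsE (e : bool * 'I_d -> nat -> 'I_d -> R) :
    \matrix_(i < n + n, j < n + n) e (nth (false, x0) (glue a a) i) j (nth x0 w j) =
    col_mx (\matrix_(i < n, j < n + n) e (false, nth x0 a i) j (nth x0 w j))
           (\matrix_(i < n, j < n + n) e (true, nth x0 a i) j (nth x0 w j)).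
  apply/matrixP => i j; case: (split_ordP i) => i' ->.
    by rewrite col_mxEu !mxE nth_cat size_map sz_a /= ltn_ord (nth_map x0) ?sz_a.
  rewrite col_mxEd !mxE nth_cat size_map sz_a ltnNge leq_addr addKn /=.
  by rewrite (nth_map x0) ?sz_a.
rewrite !rowsE.
pose C : 'M[R]_(n + n) := block_mx 1%:M 1%:M 1%:M (- 1%:M).
have -> : (-2) ^+ n = \det C.
  have -> : C = block_mx 1%:M 0 1%:M 1%:M *m block_mx 1%:M 1%:M 0 (-2)%:M.
    rewrite mulmx_block !mul1mx !mulmx0 !mul0mx !addr0 /C; congr block_mx.
    by rewrite raddfN raddfD opprD addrA subrr sub0r.
  by rewrite det_mulmx det_lblock det_ublock !det1 !mul1r det_scalar.
rewrite -det_mulmx mul_block_col !mul1mx mulNmx mul1mx.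
congr (\det (col_mx _ _)); apply/matrixP => i j; rewrite !mxE /sign_row /parity_row /=.
  by rewrite mul0n expr0 mul1r; case: (odd j); rewrite ?addr0 ?add0r.
rewrite mul1n -signr_odd; case: (odd j) => /=.
  by rewrite mulN1r sub0r.
by rewrite mul1r subr0.
Qed.

Lemma alt_enum : alt0 (enum 'I_d) = inv_d R d.
Proof.
apply/malgP => w; have sz_e : size (enum 'I_d) = d := size_enum_ord d.
rewrite (mcoeff_alt _ _ x0 _ sz_e) /inv_d (raddf_sum (mcoeff w)) /=.
have [sz_w|sz_w] := eqVneq; last first.
  rewrite mul0r big1 // => s _; rewrite mcoeffZ mcoeff_word.
  have [eq_w|] := eqVneq; last by rewrite mulr0.
  by rewrite -eq_w size_map sz_e eqxx in sz_w.
rewrite mul1r -det_tr /determinant; apply: eq_bigr => s _.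
rewrite mcoeffZ mcoeff_word; congr (_ * _).
have [eq_w|neq_w] := eqVneq.
  rewrite big1 // => i _; rewrite !mxE /plain_row nth_ord_enum -eq_w.
  by rewrite (nth_map x0) ?sz_e // nth_ord_enum eqxx.
have [i neq_i] : exists i, s i != nth x0 w i.
  apply/existsP; rewrite -negb_forall; apply: contra neq_w => /forallP eq_w.
  apply/eqP; apply: (@eq_from_nth _ x0) => [|i]; rewrite size_map sz_e //.
  by move=> lt_i; rewrite (nth_map x0) ?sz_e // (nth_ord_enum x0 (Ordinal lt_i)) (eqP (eq_w _)).
by rewrite (bigD1 i) //= !mxE /plain_row nth_ord_enum (negPf neq_i) mul0r.
Qed.

Lemma two_letter_enum : (two_letter_mx d (enum 'I_d) (enum 'I_d))^T = two_letter_matrix R d.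
Proof. by apply/matrixP => i j; rewrite !mxE !nth_ord_enum. Qed.

End Glue.

(** The signs of [altM], [alt_sign_parity] and [det_two_letter] multiply to
(-1)^(d * d + d) = 1. *)
Lemma inv_d_square (R : comNzRingType) d : (1 <= d)%N ->
  2 ^+ d *: \det (two_letter_matrix R d) = inv_d R d * inv_d R d.
Proof.
move=> hd; pose x0 := Ordinal hd; have sz_e := size_enum_ord d.
rewrite -(alt_enum R x0) (altM R x0 sz_e sz_e) (alt_sign_parity R x0 sz_e).
rewrite -(two_letter_enum R x0) det_tr (det_two_letter R x0 sz_e sz_e) !scalerA.
congr (_ *: _); rewrite [(-2) ^+ d]exprNn mulrA -exprD mulrC; congr (_ * _).
by apply: eq_sign; rewrite !oddD oddM; case: (odd d); case: (odd 'C(d, 2)).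
Qed.

(* [*] and [\det] are those of [shuffle_alg R d], i.e. the shuffle product. *)
Theorem corollary3p23 (R : realType) (d : nat) (hd : (1 <= d)%N) :
  2 ^+ d *: \det (two_letter_matrix R d) = inv_d R d * inv_d R d.
Proof. exact: inv_d_square. Qed.
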